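(* Let $T_0>0$, $s\in(1/2,1)$, and $T_k=T_0/k^s$ for $k=1,2,\dots$. Let the function $x\mapsto\min\{0,g_1(x)\}$ have compact level sets. Let $f:\mathbb{R}^n\to\mathbb{R}$ be $1$-smooth and either convex or such that $2\delta-\beta>0$, and let $g:\mathbb{R}^n\to\mathbb{R}^{n_{\rm g}}$ satisfy the Mangasarian-Fromovitz constraint qualification (at every point of $C=\{x: g(x)\ge0\}$). Let $x_k,u_k$ be the iterates, for arbitrary initial values $(x_0,u_0)\in\mathbb{R}^{2n}$, defined by $$u_{k+1}=\operatorname*{argmin}_{v\in\mathbb{R}^n}\ \tfrac12\big|v-u_k+2\delta u_kT_k+\nabla f(x_k+\beta u_k)T_k\big|^2\quad\text{s.t.}\quad \nabla g_i(x_k)^{T}v+\alpha g_i(x_k)\ge 0,\ \ i\in I_{x_k},$$ $$x_{k+1}=x_k+T_ku_{k+1}.$$ If $u_k$ is bounded and the stationary points are isolated, then $x_k$ converges to a stationary point of the problem $\min_{x\in\mathbb{R}^n}f(x)$ s.t. $g(x)\ge 0$, while $u_k$ converges to zero.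
   Context: Standing assumptions: $f$ is coercive and $C:=\{x\in\mathbb{R}^n : g(x)\ge 0\}$ is compact; $g$ is smooth (differentiable with Lipschitz gradients). $1$-smooth means differentiable with $1$-Lipschitz gradient. The constants satisfy $\alpha>0$, $\delta>0$, $\beta\ge0$. The step at $k=0$ uses the step size $T_0$. The iterates are assumed well defined, i.e. the feasible set of the minimization is nonempty at each iterate. $I_x:=\{i\in\{1,\dots,n_{\rm g}\}: g_i(x)\le 0\}$. Compact level sets: the sets $\{x : \min\{0,g_1(x)\}\ge c\}$ are compact for all $c\in\mathbb{R}$. Mangasarian-Fromovitz constraint qualification at $x$: there is $w\in\mathbb{R}^n$ with $\nabla g_i(x)^{T}w>0$ for all $i\in I_x$. Stationary point: $x\in C$ for which there is $\lambda\in\mathbb{R}^{n_{\rm g}}$, $\lambda\ge0$, with $\nabla f(x)=\sum_i\nabla g_i(x)\lambda_i$ and $\lambda_ig_i(x)=0$ for all $i$. *)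

(* Defs.v *)
From HB Require Import structures.
From mathcomp Require Import all_boot all_order all_algebra.
From mathcomp Require Import all_classical all_reals all_analysis.

Set Implicit Arguments.
Unset Strict Implicit.
Unset Printing Implicit Defensive.

Import Order.TTheory GRing.Theory Num.Theory numFieldNormedType.Exports.

Local Open Scope classical_set_scope.
Local Open Scope ring_scope.

(* Points of R^n are row vectors, as in the library's differential calculus,
   so the inner product of u and v is u *m v^T.  The library norm `|u| on 'rV
   is the sup norm: same topology and bounded sets, but not the same Lipschitz
   constants or projections, hence enorm. *)
Definition dotp (R : realType) (n : nat) (u v : 'rV[R]_n) : R :=
  (u *m v^T) 0 0.

Definition enorm (R : realType) (n : nat) (u : 'rV[R]_n) : R :=
  Num.sqrt (dotp u u).

Definition grad (R : realType) (n : nat) (f : 'rV[R]_n -> R) (x : 'rV[R]_n) :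
    'rV[R]_n :=
  \row_j 'd f x (delta_mx 0 j).

Definition smooth_with (R : realType) (n : nat) (L : R) (f : 'rV[R]_n -> R) :
    Prop :=
  (forall x, differentiable f x) /\
  (forall x y, enorm (grad f x - grad f y) <= L * enorm (x - y)).

Definition coercive (R : realType) (n : nat) (f : 'rV[R]_n -> R) : Prop :=
  forall A : R, exists r : R, forall x, r <= enorm x -> A <= f x.

(* The function g_{i+1}: constraint indices start at 0. *)
Definition constr (R : realType) (n m : nat) (g : 'rV[R]_n -> 'rV[R]_m)
    (i : 'I_m) : 'rV[R]_n -> R :=
  fun x => g x 0 i.

Definition feasible (R : realType) (n m : nat) (g : 'rV[R]_n -> 'rV[R]_m) :
    set 'rV[R]_n :=
  [set x | forall i, 0 <= constr g i x].

(* Violated constraints are included, so x need not be feasible. *)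
Definition active (R : realType) (n m : nat) (g : 'rV[R]_n -> 'rV[R]_m)
    (x : 'rV[R]_n) : {set 'I_m} :=
  [set i | constr g i x <= 0]%SET.

Definition MFCQ (R : realType) (n m : nat) (g : 'rV[R]_n -> 'rV[R]_m)
    (x : 'rV[R]_n) : Prop :=
  exists w : 'rV[R]_n,
    forall i, i \in active g x -> 0 < dotp (grad (constr g i) x) w.

Definition stationary (R : realType) (n m : nat) (f : 'rV[R]_n -> R)
    (g : 'rV[R]_n -> 'rV[R]_m) : set 'rV[R]_n :=
  [set x | feasible g x /\
    exists lam : 'I_m -> R,
      [/\ forall i, 0 <= lam i,
          grad f x = \sum_i lam i *: grad (constr g i) x &
          forall i, lam i * constr g i x = 0]].

Definition compact_level_sets (R : realType) (n : nat) (h : 'rV[R]_n -> R) :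
    Prop :=
  forall c : R, compact [set x | c <= h x].

Definition is_argmin (R : realType) (T : Type) (J : T -> R) (D : set T)
    (v : T) : Prop :=
  D v /\ forall w, D w -> J v <= J w.

(* The case k = 0 is separate because 0 `^ s = 0 for s <> 0. *)
Definition step (R : realType) (T0 s : R) (k : nat) : R :=
  if k == 0%N then T0 else T0 / k%:R `^ s.

Definition velocity_set (R : realType) (n m : nat) (alpha : R)
    (g : 'rV[R]_n -> 'rV[R]_m) (x : 'rV[R]_n) : set 'rV[R]_n :=
  [set v | forall i, i \in active g x ->
    0 <= dotp (grad (constr g i) x) v + alpha * constr g i x].

Definition velocity_cost (R : realType) (n : nat) (delta beta : R)
    (f : 'rV[R]_n -> R) (T : R) (x u v : 'rV[R]_n) : R :=
  2^-1 * enorm (v - u + (2 * delta * T) *: u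
                + T *: grad f (x + beta *: u)) ^+ 2.

(* An argmin over an empty velocity_set does not exist, so the relation forces
   the minimization to be feasible at every iterate. *)
Definition iterates (R : realType) (n m : nat) (alpha delta beta : R)
    (f : 'rV[R]_n -> R) (g : 'rV[R]_n -> 'rV[R]_m) (T : nat -> R)
    (x u : nat -> 'rV[R]_n) : Prop :=
  forall k : nat,
    is_argmin (velocity_cost delta beta f (T k) (x k) (u k))
      (velocity_set alpha g (x k)) (u k.+1) /\
    x k.+1 = x k + T k *: u k.+1.

(* Main.v *)
Require Import Defs.
From HB Require Import structures.
From mathcomp Require Import all_boot all_order all_algebra.
From mathcomp Require Import all_classical all_reals all_analysis.
From mathcomp Require Import ring lra.

Set Implicit Arguments.
Unset Strict Implicit.
Unset Printing Implicit Defensive.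

Import Order.TTheory GRing.Theory Num.Theory numFieldNormedType.Exports.

Local Open Scope classical_set_scope.
Local Open Scope ring_scope.

(** Discretized friction: subject to the constraints, the velocity follows
    [u' = - 2 delta u - grad f (x + beta u)], and constraint forces act through
    the projection.  Write [w] for the unconstrained update
    [u_k - T_k (2 delta u_k + grad f (x_k + beta u_k))] and [nu = u_{k+1} - w]
    for the impulse that the projection adds; [nu] makes a nonnegative product
    with [v - u_{k+1}] for every admissible velocity [v]
    ([impulse_variational]).

    Feasibility.  A violated constraint is contracted by [1 - alpha T_k] up to
    [O(T_k ^ 2)], a satisfied one can be overshot by [O(T_k)] only.  Since
    [T_k - T_{k+1} = o(T_k ^ 2)] (this is where [s < 1] matters), all violations
    are [O(T_k)] ([contracted_or_reset], [violation_small]).  For the constraint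
    with compact level sets this confines [x_k] to a compact set.

    Energy.  Let [V = |u| ^ 2 / 2 + f x].  By MFCQ, uniform on compact sets, the
    point [x_k] has an admissible velocity of size [O(T_k)], so the impulse does
    work [O(T_k |nu|)] at most.  The loss [- |nu| ^ 2 / 2] caused by the
    projection absorbs this and all other terms linear in [nu], even when [nu]
    is an impact of size [O(1)]:
    [V_{k+1} <= V_k - c T_k |u_k| ^ 2 + O(T_k ^ 2)] and
    [|u_{k+1}| ^ 2 <= |u_k| ^ 2 + O(T_k)] ([energy_step]).  The squares of the
    steps are summable ([s > 1/2]), hence so is [T_k |u_k| ^ 2]; as the steps
    themselves are not summable and [|u_k| ^ 2] cannot jump up, [u_k] tends to
    zero ([weighted_summable_cvg0], [velocity_vanishes]).

    Stationarity.  Let [y] be a cluster point of [x_k], feasible by the above.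
    If [y] is not stationary, Gordan's theorem yields a direction [d] with
    [grad f y . d < 0] and [grad g_i y . d > 0] for the active [i].  Near [y]
    the velocity [u_{k+1} + d] is admissible, so the impulse never opposes [d]
    and [u_k . d] grows at a fixed rate per unit of time.  As [u_k] is small,
    [x_k] cannot leave the neighbourhood before [u_k . d] contradicts that
    smallness ([cluster_stationary]).

    Convergence.  The increments of [x_k] tend to zero and its cluster points
    are isolated, so [x_k] cannot travel from one to another
    ([isolated_cluster_cvg]). *)

(** * Euclidean inner product and norm *)

(* [lra] compares its atoms up to conversion, which unfolds inner products of
   gradients; hiding the atoms behind variables first keeps it fast. *)
Ltac atom_lra :=
  repeat match goal with H : is_true _ |- _ => revert H end;
  repeat match goal with
  | |- context [@dotp ?R ?n ?u ?v] => generalize (@dotp R n u v)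
  | |- context [@enorm ?R ?n ?u] => generalize (@enorm R n u)
  end; intros; lra.

Section Dotp.
Context {R : realType} {n : nat}.
Implicit Types (u v w : 'rV[R]_n) (a t : R).

Lemma dotpE u v : dotp u v = \sum_j u 0 j * v 0 j.
Proof. by rewrite /dotp mxE; apply: eq_bigr => j _; rewrite mxE. Qed.

Lemma dotpC u v : dotp u v = dotp v u.
Proof. by rewrite !dotpE; apply: eq_bigr => j _; rewrite mulrC. Qed.

Lemma dotpDl u v w : dotp (u + v) w = dotp u w + dotp v w.
Proof. by rewrite /dotp mulmxDl mxE. Qed.

Lemma dotpDr u v w : dotp w (u + v) = dotp w u + dotp w v.
Proof. by rewrite dotpC dotpDl !(dotpC w). Qed.

Lemma dotpZl a u v : dotp (a *: u) v = a * dotp u v.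
Proof. by rewrite /dotp -scalemxAl mxE. Qed.

Lemma dotpZr a u v : dotp u (a *: v) = a * dotp u v.
Proof. by rewrite dotpC dotpZl dotpC. Qed.

Lemma dotpNl u v : dotp (- u) v = - dotp u v.
Proof. by rewrite -scaleN1r dotpZl mulN1r. Qed.

Lemma dotpNr u v : dotp u (- v) = - dotp u v.
Proof. by rewrite dotpC dotpNl dotpC. Qed.

Definition dotp_lin := (dotpDl, dotpDr, dotpZl, dotpZr, dotpNl, dotpNr).

Lemma dotp_suml (I : finType) (P : pred I) (c : I -> 'rV[R]_n) v :
  dotp (\sum_(i | P i) c i) v = \sum_(i | P i) dotp (c i) v.
Proof. by rewrite /dotp mulmx_suml summxE. Qed.

Lemma dotp_ge0 u : 0 <= dotp u u.
Proof. by rewrite dotpE; apply: sumr_ge0 => j _; rewrite -expr2 sqr_ge0. Qed.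

Lemma dotp_eq0 u : dotp u u = 0 -> u = 0.
Proof.
move=> /eqP; rewrite dotpE psumr_eq0; last by move=> j _; rewrite -expr2 sqr_ge0.
move=> /allP h; apply/rowP => j; rewrite mxE.
by have := h j (mem_index_enum _); rewrite -expr2 sqrf_eq0 => /eqP.
Qed.

Lemma enorm_ge0 u : 0 <= enorm u.
Proof. exact: sqrtr_ge0. Qed.

Lemma enorm_sqr u : enorm u ^+ 2 = dotp u u.
Proof. by rewrite sqr_sqrtr// dotp_ge0. Qed.

Lemma enormZ a u : enorm (a *: u) = `|a| * enorm u.
Proof.
by rewrite /enorm dotpZl dotpZr mulrA -expr2 sqrtrM ?sqr_ge0// sqrtr_sqr.
Qed.

Lemma enormN u : enorm (- u) = enorm u.
Proof. by rewrite /enorm dotpNl dotpNr opprK. Qed.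

Lemma cauchy_schwarz u v : `|dotp u v| <= enorm u * enorm v.
Proof.
have [v0|v0] := eqVneq (dotp v v) 0.
  by rewrite (dotp_eq0 v0) -(scale0r 0) dotpZr mul0r normr0 mulr_ge0// enorm_ge0.
have vv : 0 < dotp v v by rewrite lt_neqAle eq_sym v0 dotp_ge0.
rewrite -(@ler_pXn2r _ 2)// ?nnegrE ?mulr_ge0// ?enorm_ge0//.
rewrite exprMn !enorm_sqr real_normK ?num_real//.
have := dotp_ge0 (dotp v v *: u - dotp u v *: v).
rewrite !dotp_lin (dotpC v u) => h.
have : 0 <= dotp v v * (dotp u u * dotp v v - dotp u v ^+ 2) by lra.
by rewrite pmulr_rge0// subr_ge0.
Qed.

Lemma dotp_le u v : dotp u v <= enorm u * enorm v.
Proof. exact: le_trans (ler_norm _) (cauchy_schwarz u v). Qed.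

Lemma dotp_geN u v : - (enorm u * enorm v) <= dotp u v.
Proof. by have := cauchy_schwarz u v; rewrite ler_norml => /andP[]. Qed.

Lemma enormD u v : enorm (u + v) <= enorm u + enorm v.
Proof.
rewrite -(@ler_pXn2r _ 2)// ?nnegrE ?addr_ge0 ?enorm_ge0//.
rewrite sqrrD !enorm_sqr !dotp_lin (dotpC v u).
have := dotp_le u v; lra.
Qed.

Lemma enorm_distC u v : enorm (u - v) = enorm (v - u).
Proof. by rewrite -enormN opprB. Qed.

Lemma enorm_le_distD u v : enorm u <= enorm v + enorm (u - v).
Proof. by rewrite -{1}(subrKC v u) enormD. Qed.

Lemma norm_le_enorm u : `|u| <= enorm u.
Proof.
have [->|u0] := eqVneq u 0; first by rewrite normr0 enorm_ge0.
have /mx_norm_neq0 [[i j]] : mx_norm u != 0.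
  by apply: contra_neq u0; exact: mx_norm_eq0.
rewrite (ord1 i) /= => uj; have -> : `|u| = `|u 0 j| by exact: uj.
rewrite -(@ler_pXn2r _ 2)// ?nnegrE ?enorm_ge0//.
rewrite enorm_sqr real_normK ?num_real// dotpE (bigD1 j)//= -expr2 lerDl.
by apply: sumr_ge0 => k _; rewrite -expr2 sqr_ge0.
Qed.

Lemma enorm_le_norm u : enorm u <= n.+1%:R * `|u|.
Proof.
rewrite -(@ler_pXn2r _ 2)// ?nnegrE ?enorm_ge0 ?mulr_ge0//.
rewrite enorm_sqr dotpE exprMn.
have le j : u 0 j * u 0 j <= `|u| ^+ 2.
  rewrite -expr2 -[X in X <= _]real_normK ?num_real// lerXn2r ?nnegrE//.
  rewrite [leRHS]/Num.norm/= mx_normrE.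
  exact: (le_bigmax 0 (fun ij : 'I_1 * 'I_n => `|u ij.1 ij.2|) (0, j)).
apply: le_trans (ler_sum _ (fun j _ => le j)) _.
rewrite sumr_const card_ord -[leLHS]mulr_natl ler_wpM2r ?sqr_ge0//.
by rewrite -natrX ler_nat (leq_trans (leqnSn n))// leq_pmulr.
Qed.

(** The topology of ['rV] comes from the sup norm, the estimates below are
    Euclidean; neighbourhoods are translated here once and for all. *)
Lemma nbhs_enorm u (P : set 'rV[R]_n) :
  nbhs u P <-> exists2 e : R, 0 < e & forall v, enorm (v - u) < e -> P v.
Proof.
split=> [/nbhs_ballP[e /= e0 eP]|[e e0 eP]].
  exists e => // v vu; apply: eP; rewrite -ball_normE/=.
  by rewrite distrC (le_lt_trans (norm_le_enorm _)).
apply/nbhs_ballP; exists (e / n.+1%:R); rewrite /= ?divr_gt0// => v.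
rewrite -ball_normE/= distrC => vu; apply: eP.
rewrite (le_lt_trans (enorm_le_norm _))// mulrC -ltr_pdivlMr//.
Qed.

End Dotp.

(** * Functions with Lipschitz gradient *)

Section Smooth.
Context {R : realType} {n : nat}.
Implicit Types (x y v : 'rV[R]_n) (f : 'rV[R]_n -> R) (L : R).

Lemma diff_grad f x v : differentiable f x -> 'd f x v = dotp (grad f x) v.
Proof.
move=> df; rewrite {1}[v]row_sum_delta linear_sum dotpE; apply: eq_bigr => j _.
by rewrite linearZ mxE /= mulrC.
Qed.

Lemma is_derive_line f x v (t : R) : differentiable f (x + t *: v) ->
  is_derive t 1 (fun s : R => f (x + s *: v)) (dotp (grad f (x + t *: v)) v).
Proof.
move=> df.
have dl : is_diff t (fun s : R => x + s *: v) (fun s : R => s *: v).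
  rewrite [X in is_diff _ _ X](_ : _ = cst 0 + ( *:%R^~ v)); last first.
    by apply/funext => s /=; rewrite fctE add0r.
  exact: is_diffD.
have df' : is_diff (x + t *: v) f ('d f (x + t *: v)) by exact: differentiableP.
have := @is_diff_comp _ _ _ _ _ _ _ _ _ dl df' => h.
have hd : differentiable (f \o (fun s : R => x + s *: v)) t by exact: ex_diff.
apply: DeriveDef; first exact: diff_derivable.
rewrite -[LHS]/('D_1 (f \o (fun s : R => x + s *: v)) t).
rewrite deriveE// diff_val/= scale1r.
exact: diff_grad.
Qed.

Lemma smooth_with_max0 L f : smooth_with L f -> smooth_with (Num.max 0 L) f.
Proof.
case=> df lip; split=> // x y; apply: le_trans (lip x y) _.
by rewrite ler_wpM2r ?enorm_ge0// le_max lexx orbT.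
Qed.

(** Mean value theorem along the segment.  The optimal constant [L / 2] would
    need an integral; only the order in [v] matters below. *)
Lemma smooth_taylor L f x v : 0 <= L -> smooth_with L f ->
  `|f (x + v) - f x - dotp (grad f x) v| <= L * enorm v ^+ 2.
Proof.
move=> L0 [df lip].
have dl (t : R) := is_derive_line (df (x + t *: v)).
have [|t t01] := @MVT_segment R (fun s => f (x + s *: v))
    (fun t => dotp (grad f (x + t *: v)) v) 0 1 ler01 (fun t _ => dl t).
  apply: continuous_subspaceT => t.
  apply: differentiable_continuous; apply/derivable1_diffP; exact: ex_derive.
rewrite scale0r scale1r addr0 subr0 mulr1 => ->.
rewrite -dotpNl -dotpDl (le_trans (cauchy_schwarz _ _))//.
rewrite expr2 mulrA ler_wpM2r ?enorm_ge0// (le_trans (lip _ _))//.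
rewrite addrAC subrr add0r ler_wpM2l// enormZ ler_piMl ?enorm_ge0//.
by move: t01; rewrite in_itv/= => /andP[t0 t1]; rewrite ger0_norm.
Qed.

Lemma grad_bound L f x : smooth_with L f ->
  enorm (grad f x) <= enorm (grad f 0) + L * enorm x.
Proof.
move=> [_ lip]; apply: le_trans (enorm_le_distD _ (grad f 0)) _.
by rewrite lerD2l -{2}(subr0 x).
Qed.

(** First-order condition at [t = 0], for a quadratic function of [t] that is
    minimal there and has been divided by [t]. *)
Lemma affine_ge0 (a b : R) :
  (forall t : R, 0 < t -> t <= 1 -> 0 <= a + t * b) -> 0 <= a.
Proof.
move=> h; rewrite leNgt; apply/negP => a0.
pose t := - a / (1 + `|b| - a).
have b0 : 0 <= `|b| by [].
have d0 : 0 < 1 + `|b| - a by lra.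
have t0 : 0 < t by rewrite divr_gt0// oppr_gt0.
have t1 : t <= 1 by rewrite ler_pdivrMr// mul1r; lra.
have := h t t0 t1.
have : t * b <= t * `|b| by rewrite ler_pM2l// ler_norm.
have : t * (1 + `|b| - a) = - a by rewrite divfK// gt_eqF.
nra.
Qed.

Lemma convex_grad_monotone L f x v : 0 <= L -> smooth_with L f ->
  convex_function setT f -> 0 <= dotp (grad f (x + v) - grad f x) v.
Proof.
move=> L0 sf cf.
(* The graph lies above its tangents; apply this at both end points. *)
have key y w : dotp (grad f y) w <= f (y + w) - f y.
  rewrite -subr_ge0; apply: (@affine_ge0 _ (L * enorm w ^+ 2)) => t t0 t1.
  have := cf (Itv01 (ltW t0) t1) (y + w) y; rewrite !inE => /(_ I I).
  rewrite convRE [X in f X <= _](_ : _ = y + t *: w); last first.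
    rewrite /conv/= scalerDr scalerBl scale1r.
    by rewrite addrC addrA subrK.
  rewrite /= => cfy.
  have := smooth_taylor y (t *: w) L0 sf.
  rewrite enormZ dotpZr (gtr0_norm t0) => /ler_normlP[tay _].
  rewrite -(pmulr_rge0 _ t0); move: cfy tay; rewrite /unstable.onem exprMn.
  lra.
have := key (x + v) (- v); have := key x v.
rewrite addrK; move: (grad f x) (grad f (x + v)) => a b.
rewrite !dotp_lin; lra.
Qed.

End Smooth.

(** * Recursive inequalities with vanishing steps *)

Section Series.
Context {R : realType}.
Implicit Types (u v b e V T y p : R^nat) (k : nat).

Lemma series_ub u : cvgn (series u) ->
  exists B : R, forall k, series u k <= B.
Proof.
move=> /cvg_seq_bounded/bounded_fun_has_ubound[M uM].
by exists M => k; apply: uM; exists k.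
Qed.

Lemma nonneg_series_cvg u (B : R) : (forall k, 0 <= u k) ->
  (forall k, series u k <= B) -> cvgn (series u).
Proof.
move=> u0 uB; apply: nondecreasing_is_cvgn; first exact: nondecreasing_series.
by exists B => _ [k _ <-].
Qed.

Lemma series_ge0 u k : (forall k, 0 <= u k) -> 0 <= series u k.
Proof. by move=> u0; exact: sumr_ge0. Qed.

(** [V + series e - series b] is finally nonincreasing and bounded below. *)
Lemma perturbed_descent V e b (m : R) :
  (forall k, 0 <= e k) -> (forall k, 0 <= b k) -> cvgn (series b) ->
  (forall k, m <= V k) ->
  (\forall k \near \oo, V k.+1 <= V k - e k + b k) ->
  cvgn (series e) /\ cvgn V.
Proof.
move=> e0 b0 cb mV [N _ VN].
have [B bB] := series_ub cb.
pose W k := V k + series e k - series b k.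
have cW : cvgn W.
  apply: (@near_nonincreasing_is_cvgn _ _ (m - B)).
    exists N => // k /= Nk l kl.
    rewrite -(subnKC kl); elim: (l - k)%N => [|j ih]; first by rewrite addn0.
    rewrite (le_trans _ ih)// addnS /W !seriesSr.
    by have := VN (k + j)%N (leq_trans Nk (leq_addr _ _)); lra.
  apply: nearW => k; rewrite /W.
  by have := bB k; have := mV k; have := series_ge0 k e0; lra.
have ce : cvgn (series e).
  have [M WM] := bounded_fun_has_ubound (cvg_seq_bounded cW).
  apply: (@nonneg_series_cvg _ (M - m + B)) => // k.
  by have := WM (W k) (ex_intro2 _ _ k I erefl); have := bB k; have := mV k;
    rewrite /W; lra.
split=> //; rewrite (_ : V = W - series e + series b).
  by apply: is_cvgD => //; apply: is_cvgB.
by apply/funext => k; rewrite /W !fctE; lra.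
Qed.

Lemma near_series_le_cvg u v : (forall k, 0 <= u k) -> (forall k, 0 <= v k) ->
  (\forall k \near \oo, u k <= v k) -> cvgn (series v) -> cvgn (series u).
Proof.
move=> u0 v0 uv cv.
(* A constant [V] whose dissipation is [u] and whose perturbation is [v]. *)
have uv0 : \forall k \near \oo, 0 <= 0 - u k + v k.
  by apply: filterS uv => k; lra.
by have [] := @perturbed_descent (cst 0) u v 0 u0 v0 cv (fun=> lexx _) uv0.
Qed.

(** [steps_slow] says [T k - T k.+1 = o(T k ^ 2)]: a contraction at rate [T]
    then outpaces the decay of [T] itself. *)
Record vanishing_steps T : Prop := VanishingSteps {
  steps_gt0 : forall k, 0 < T k;
  steps_sqr : cvgn (series (fun k => T k ^+ 2));
  steps_dvg : ~ cvgn (series T);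
  steps_slow : forall a : R, 0 < a ->
    \forall k \near \oo, T k - T k.+1 <= a * T k ^+ 2 }.

Lemma steps_small T (e : R) : vanishing_steps T -> 0 < e ->
  \forall k \near \oo, T k < e.
Proof.
move=> vT e0; have := cvg_series_cvg_0 (steps_sqr vT).
move=> /cvgrPdist_lt /(_ (e ^+ 2)); rewrite exprn_gt0// => /(_ isT).
apply: filterS => k; rewrite sub0r normrN ger0_norm ?sqr_ge0//.
by rewrite ltr_pXn2r// nnegrE ltW// (steps_gt0 vT).
Qed.

Lemma steps_dvgP T (B : R) : vanishing_steps T -> exists k, B < series T k.
Proof.
move=> vT; apply: contrapT => h; apply: (steps_dvg vT).
apply: (@nonneg_series_cvg _ B) => k; first exact/ltW/(steps_gt0 vT).
by rewrite leNgt; apply/negP => ?; apply: h; exists k.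
Qed.

(** Squaring [y k.+1 <= y k + D * T k] makes the perturbation summable: its cross
    term is the summable [T * y].  Hence [y ^ 2] converges, and a positive limit
    would make [T] summable. *)
Lemma weighted_summable_cvg0 T y (D : R) : vanishing_steps T -> 0 <= D ->
  (forall k, 0 <= y k) -> cvgn (series (fun k => T k * y k)) ->
  (\forall k \near \oo, y k.+1 <= y k + D * T k) ->
  y @ \oo --> 0.
Proof.
move=> vT D0 y0 cTy yS.
have T0 k : 0 <= T k by exact/ltW/(steps_gt0 vT).
pose b k := 2 * D * (T k * y k) + D ^+ 2 * T k ^+ 2.
have [|||||_ cy2] := @perturbed_descent (fun k => y k ^+ 2) (cst 0) b 0.
- by move=> k; exact: lexx.
- by move=> k; rewrite /b addr_ge0 ?mulr_ge0 ?sqr_ge0// T0.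
- rewrite (_ : b = (2 * D) *: (fun k => T k * y k) +
                   D ^+ 2 *: (fun k => T k ^+ 2)) //.
  by apply: is_cvg_seriesD; apply: is_cvg_seriesZ => //; exact: steps_sqr.
- by move=> k; exact: sqr_ge0.
- apply: filterS yS => k yk; rewrite /cst subr0.
  apply: (@le_trans _ _ ((y k + D * T k) ^+ 2)); last by rewrite /b; lra.
  by rewrite ler_pXn2r ?nnegrE// addr_ge0// mulr_ge0.
have [l yl] : exists l : R, y @ \oo --> l.
  move/cvg_ex: cy2 => /= [l2 yl2]; exists (Num.sqrt l2).
  rewrite (_ : y = Num.sqrt \o (fun k => y k ^+ 2)); last first.
    by apply/funext => k /=; rewrite sqrtr_sqr ger0_norm.
  apply: continuous_cvg; [exact: sqrt_continuous|exact: yl2].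
have [l0|l0] := ltP 0 l; last first.
  suff -> : 0 = l by [].
  apply/eqP; rewrite eq_le l0 andbT -(cvg_lim _ yl)//.
  by apply: limr_ge; [exact: cvgP yl|exact: nearW].
exfalso; apply: (steps_dvg vT).
have l2 : 0 < l / 2 by rewrite divr_gt0.
apply: (@near_series_le_cvg _ ((2 / l) *: (fun k => T k * y k))) => //.
- by move=> k; rewrite fctE /GRing.scale/= !mulr_ge0// ?T0// invr_ge0 ltW.
- have /cvgrPdist_lt/(_ _ l2) := yl; apply: filterS => k.
  move=> /ltr_normlP[_ lty]; have {}lty : l / 2 <= y k by lra.
  rewrite fctE /GRing.scale/= mulrCA ler_peMr// ?T0//.
  by rewrite mulrAC ler_pdivlMr//; lra.
- exact: is_cvg_seriesZ.
Qed.

(** The bound [p k <= M * T k] is preserved: contraction gains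
    [(a * M - c) * T k ^ 2 >= (a * M / 2) * T k ^ 2], and [M * T] only loses
    [M * (T k - T k.+1)], which is less by [steps_slow]. *)
Lemma contracted_or_reset T p (a c : R) : vanishing_steps T -> 0 < a -> 0 <= c ->
  (forall k, 0 <= p k) ->
  (\forall k \near \oo, p k.+1 <= (1 - a * T k) * p k + c * T k ^+ 2 \/
                        p k.+1 <= c * T k) ->
  exists2 M : R, 0 <= M & \forall k \near \oo, p k <= M * T k.
Proof.
move=> vT a0 c0 p0 pS.
have a2 : 0 < a / 2 by rewrite divr_gt0.
have a1 : 0 < a^-1 by rewrite invr_gt0.
have [N _ h] : \forall k \near \oo,
    [/\ p k.+1 <= (1 - a * T k) * p k + c * T k ^+ 2 \/ p k.+1 <= c * T k,
        a * T k <= 1 & T k - T k.+1 <= (a / 2) * T k ^+ 2].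
  near=> k; split; first by near: k.
  - rewrite -ler_pdivlMl// mulr1 ltW//; near: k; exact: steps_small vT a1.
  - by near: k; exact: (steps_slow vT).
have T0 k := steps_gt0 vT k.
(* The summands serve the base case, the contraction and the reset. *)
pose M := p N / T N + 2 * c / a + 2 * c.
have pN0 : 0 <= p N / T N by rewrite divr_ge0// ltW.
have ca0 : 0 <= 2 * c / a by rewrite divr_ge0 ?mulr_ge0// ltW.
have M0 : 0 <= M by rewrite /M; lra.
have Ma : 2 * c <= M * a by rewrite -ler_pdivrMr// /M; lra.
exists M => //; exists N => // k /= Nk; rewrite -(subnKC Nk).
elim: (k - N)%N => [|j ih].
  by rewrite addn0 -ler_pdivrMr// /M; lra.
rewrite addnS; move: ih; set i := (N + j)%N => ih.
have [st aT sl] := h i (leq_addr _ _).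
have Ti := T0 i; have Ti1 := T0 i.+1.
have T2 : 0 <= T i ^+ 2 by exact: sqr_ge0.
have Msl : M * (T i - T i.+1) <= M * ((a / 2) * T i ^+ 2).
  by apply: ler_wpM2l.
case: st => st; apply: le_trans st _.
- have : (1 - a * T i) * p i <= (1 - a * T i) * (M * T i).
    by rewrite ler_wpM2l// subr_ge0.
  have : 2 * c * T i ^+ 2 <= M * a * T i ^+ 2 by rewrite ler_wpM2r.
  lra.
- have aT2 : a * T i * T i <= 1 * T i by rewrite ler_wpM2r// ltW.
  have : c * T i <= c * (2 * T i.+1) by rewrite ler_wpM2l//; lra.
  have : 2 * c * T i.+1 <= M * T i.+1 by rewrite ler_wpM2r ?(ltW Ti1)// /M; lra.
  lra.
Unshelve. all: by end_near. Qed.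

Lemma near_bounded_above p (M : R) : (forall k, 0 <= p k) ->
  (\forall k \near \oo, p k <= M) -> exists B : R, forall k, p k <= B.
Proof.
move=> p0 [N _ pM]; exists (series p N + M) => k.
have [Nk|kN] := leqP N k.
  by rewrite (le_trans (pM k Nk))// lerDr series_ge0.
have M0 : 0 <= M by exact: le_trans (p0 N) (pM N (leqnn N)).
rewrite (@le_trans _ _ (series p k.+1))//.
  by rewrite seriesSr lerDr series_ge0.
rewrite (@le_trans _ _ (series p N)) ?lerDl//.
exact: (nondecreasing_series (fun i _ _ => p0 i)).
Qed.

End Series.

(** * The step sizes [T0 / k ^ s] *)

Section StepSize.
Context {R : realType}.

(** Discrete form of [p * t ^ (- p - 1) = - (t ^ - p)']; the ratio of the two
    powers is bounded through [exp (p * h) >= 1 + p * h] and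
    [- ln (1 - z) >= z]. *)
Lemma riemann_telescope (p : R) (n : nat) : 0 < p ->
  p * (n.+2%:R `^ (1 + p))^-1 <= (n.+1%:R `^ p)^-1 - (n.+2%:R `^ p)^-1.
Proof.
move=> p0.
have n1 : 0 < n.+1%:R :> R by []. have n2 : 0 < n.+2%:R :> R by [].
have A0 : 0 < n.+1%:R `^ p :> R by exact: powR_gt0.
have B0 : 0 < n.+2%:R `^ p :> R by exact: powR_gt0.
have ratio : 1 + p / n.+2%:R <= n.+2%:R `^ p / n.+1%:R `^ p.
  rewrite -powRN -(mulrN1 p) mulrC [p * _]mulrC powRrM powR_inv1// -powRM ?invr_ge0//.
  rewrite /powR mulf_eq0 invr_eq0 !pnatr_eq0/=.
  apply: le_trans (expR_ge1Dx _); rewrite lerD2l mulrC ler_wpM2l// ?(ltW p0)//.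
  have -> : n.+2%:R / n.+1%:R = (1 - n.+2%:R^-1)^-1 :> R.
    rewrite -[n.+2%:R in LHS]invrK -invfM; congr (_^-1).
    by rewrite -[n.+1%:R in LHS](addrK 1) natr1 mulrBr mulVf ?pnatr_eq0// mulr1.
  have n21 : n.+2%:R^-1 < 1 :> R by rewrite invf_lt1// ltr1n.
  rewrite lnV ?posrE ?subr_gt0// lerNr.
  by apply: le_ln1Dx; rewrite ltrN2.
rewrite powRD; last by rewrite pnatr_eq0 implybT.
rewrite powRr1//.
rewrite -(ler_pM2r B0) mulrBl mulVf ?gt_eqF//.
rewrite invfM -!mulrA mulVf ?gt_eqF// mulr1.
by rewrite lerBrDl [leRHS]mulrC.
Qed.

Lemma cvg_riemannR (a : R) : 1 < a -> cvgn (series (riemannR a)).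
Proof.
move=> a1; pose p := a - 1; have p0 : 0 < p by rewrite subr_gt0.
have -> : a = 1 + p by rewrite subrKC.
apply: (@nonneg_series_cvg _ _ (1 + p^-1)) => [k|k].
  by rewrite ltW// riemannR_gt0// addr_ge0// ltW.
have p1 : 0 <= p^-1 by rewrite invr_ge0 ltW.
case: k => [|k]; first by rewrite /series/= big_geq//; lra.
have : series (riemannR (1 + p)) k.+1 <= 1 + p^-1 * (1 - (k.+1%:R `^ p)^-1).
  elim: k => [|k ih].
    by rewrite /series/= big_nat1 /riemannR !powR1/= !invr1 subrr mulr0 addr0.
  rewrite seriesSr /riemannR/=.
  have := riemann_telescope k p0.
  rewrite -(ler_pM2l (_ : 0 < p^-1)) ?invr_gt0// mulrA mulVf ?gt_eqF// mul1r.
  lra.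
move=> /le_trans; apply; rewrite lerD2l ler_piMr// gerBl invr_ge0 powR_ge0.
Qed.

Lemma step_vanishing (T0 s : R) : 0 < T0 -> 2^-1 < s -> s < 1 ->
  vanishing_steps (step T0 s).
Proof.
move=> T00 s2 s1.
have s0 : 0 < s by lra.
have stepS k : step T0 s k.+1 = T0 * riemannR s k by [].
have Tgt0 k : 0 < step T0 s k.
  by case: k => [//|k]; rewrite stepS mulr_gt0// riemannR_gt0// ltW.
have seriesST (u : R^nat) k : series u k.+1 = u 0%N + series (fun k => u k.+1) k.
  by rewrite /series/= big_nat_recl.
split=> //.
- have s21 : 1 < s * 2 by lra.
  have [B rB] := series_ub (cvg_riemannR s21).
  have B0 : 0 <= B by apply: le_trans (rB 0%N); rewrite /series/= big_geq.
  apply: (@nonneg_series_cvg _ _ (T0 ^+ 2 * (1 + B))) => [k|[|k]].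
  + exact: sqr_ge0.
  + by rewrite /series/= big_geq// mulr_ge0 ?sqr_ge0// addr_ge0.
  + rewrite seriesST mulrDr mulr1 {1}/step/= lerD2l.
    rewrite (_ : (fun k => _) = T0 ^+ 2 *: riemannR (s * 2)); last first.
      apply/funext => j; rewrite stepS fctE exprMn /riemannR powRrM.
      by rewrite powR_mulrn ?powR_ge0// exprVn.
    by rewrite seriesZ fctE ler_wpM2l ?sqr_ge0.
- move=> cT; apply: (@dvg_riemannR R s); first by lra.
  have [B TB] := series_ub cT.
  apply: (@nonneg_series_cvg _ _ (T0^-1 * B)) => k.
    by rewrite ltW// riemannR_gt0// ltW.
  rewrite mulrC ler_pdivlMr// mulrC.
  have := TB k.+1; rewrite seriesST.
  rewrite (_ : (fun k => _) = T0 *: riemannR s) // seriesZ fctE.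
  by rewrite {1}/step/= /GRing.scale/=; lra.
- move=> a a0.
  have q0 : 0 < 1 - s by lra.
  have [N _ cN] := nbhs_infty_ger ((a * T0)^-1 `^ (1 - s)^-1).
  exists N.+1 => // -[//|j] /= /ltnW/cN jc.
  rewrite !stepS /riemannR.
  have j1 : 0 < j.+1%:R :> R by [].
  have j2 : 0 < j.+2%:R :> R by [].
  have x0 : 0 < j.+1%:R `^ s :> R by exact: powR_gt0.
  have y0 : 0 < j.+2%:R `^ s :> R by exact: powR_gt0.
  have ratio : j.+1%:R / j.+2%:R <= j.+1%:R `^ s / j.+2%:R `^ s :> R.
    rewrite -powRN -mulN1r powRrM powR_inv1// -powRM ?invr_ge0//.
    by rewrite ger1_powR ?divr_gt0 ?ler_pdivrMr ?mul1r ?ler_nat//= ltW.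
  have xle : j.+1%:R `^ s <= a * T0 * j.+2%:R.
    rewrite -ler_pdivrMl ?mulr_gt0//.
    apply: (@le_trans _ _ j.+1%:R); last by rewrite ler_nat.
    rewrite [leRHS](_ : _ = j.+1%:R `^ s * j.+1%:R `^ (1 - s)); last first.
      by rewrite -powRD ?subrKC ?powRr1// pnatr_eq0 implybT.
    rewrite [leLHS]mulrC ler_pM2l//.
    have := ge0_ler_powR (ltW q0) _ _ jc; rewrite !nnegrE powR_ge0 => /(_ isT).
    rewrite ler0n => /(_ isT) /=.
    by rewrite -powRrM mulVf ?gt_eqF// powRr1// invr_ge0 mulr_ge0 ?ltW.
  rewrite exprMn -mulrBr [a * _]mulrCA expr2 -mulrA ler_pM2l// mulrCA.
  move: ratio xle; set x := j.+1%:R `^ s in x0 *; set y := j.+2%:R `^ s in y0 *.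
  have -> : x^-1 - y^-1 = x^-1 * (1 - x / y) by rewrite mulrBr mulr1 mulKf ?gt_eqF.
  have -> : j.+1%:R = j.+2%:R - 1 :> R by rewrite -[j.+2%:R]natr1 addrK.
  rewrite mulrBl divff ?gt_eqF// => ratio xle.
  rewrite [leRHS](_ : _ = x^-1 * (a * T0 / x)); last by rewrite expr2; ring.
  rewrite ler_pM2l ?invr_gt0//.
  have : j.+2%:R^-1 <= a * T0 / x.
    by rewrite ler_pdivlMr// mulrC ler_pdivrMr.
  by apply: le_trans; rewrite lerBlDr addrC -lerBlDr -[_^-1]mul1r.
Qed.

End StepSize.

(** * Compactness and isolated cluster points *)

Section Compactness.
Context {R : realType} {n : nat}.
Implicit Types (x y v w : 'rV[R]_n) (K S : set 'rV[R]_n) (xs : nat -> 'rV[R]_n).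

Lemma nbhs_enorm_ball y (e : R) : 0 < e ->
  \forall y' \near y, enorm (y' - y) < e.
Proof. by move=> e0; apply/nbhs_enorm; exists e. Qed.

Lemma compact_enorm_bounded K : compact K ->
  exists2 B : R, 0 <= B & forall y, K y -> enorm y <= B.
Proof.
move=> /compact_bounded[M [_ KM]].
have M1 : M < `|M| + 1 by rewrite (le_lt_trans (ler_norm M))// ltrDl.
exists (n.+1%:R * (`|M| + 1)) => [|y Ky]; first by rewrite mulr_ge0// addr_ge0.
by rewrite (le_trans (enorm_le_norm _))// ler_wpM2l// KM.
Qed.

Lemma cvg_enorm xs y :
  (forall e : R, 0 < e -> \forall k \near \oo, enorm (xs k - y) < e) ->
  xs @ \oo --> y.
Proof.
move=> h P /nbhs_enorm[e e0 eP]; apply: filterS (h e e0) => k; exact: eP.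
Qed.

(** Around a cluster point [y] there is an annulus without cluster points; by
    compactness the sequence finally avoids it, and increments shorter than its
    width cannot jump across, so the sequence stays inside. *)
Lemma isolated_cluster_cvg K S xs : compact K -> (forall k, K (xs k)) ->
  (forall e : R, 0 < e -> \forall k \near \oo, enorm (xs k.+1 - xs k) < e) ->
  cluster (xs @ \oo) `<=` S -> S `<=` isolated S ->
  exists2 y, S y & xs @ \oo --> y.
Proof.
move=> cK Kx dx clS isoS.
have FK : (xs @ \oo) K by exists 0%N => // k _; exact: Kx.
have [y [_ cly]] := cK _ _ FK.
exists y; first exact: clS.
have [_ [V Vy VS]] := isoS _ (clS _ cly).
have [r r0 rV] := (nbhs_enorm _ _).1 Vy.
have Sy v : S v -> enorm (v - y) < r -> v = y.
  move=> Sv vr; have : (V `&` S) v by split => //; exact: rV.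
  by rewrite VS.
apply: cvg_enorm => e e0.
pose d := Num.min e r / 2.
have m0 : 0 < Num.min e r by rewrite lt_min e0 r0.
have [mine minr] : Num.min e r <= e /\ Num.min e r <= r.
  by rewrite !ge_min !lexx orbT.
have [de dr] : d < e /\ d < r by rewrite /d; split; lra.
have d0 : 0 < d by rewrite divr_gt0.
have d20 : 0 < d / 2 by rewrite divr_gt0.
(* Points of the annulus are not cluster points, so [xs] finally avoids it. *)
have : \forall k \near \oo,
    K `<=` (fun v => xs k = v -> ~ (d / 2 <= enorm (v - y) <= d)).
  apply: ((compact_near_coveringP K).1 cK) => v Kv.
  have [clv|nclv] := pselect (cluster (xs @ \oo) v); last first.
    move/existsNP: nclv => [A /existsNP[B /not_implyP[FA /not_implyP[nB AB]]]].
    near=> v' k => /= xv' _; apply: AB; exists v'; split; last by near: v'.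
    rewrite -xv'; near: k; exact: FA.
  have [->|vy] := eqVneq v y.
    near=> v' k => /= _ /andP[+ _]; apply/negP; rewrite -ltNge.
    by near: v'; exact: nbhs_enorm_ball.
  have rv : r <= enorm (v - y).
    rewrite leNgt; apply: contra_neqN vy; exact: Sy (clS _ clv).
  near=> v' k => /= _ /andP[_]; apply/negP; rewrite -ltNge.
  have : enorm (v' - v) < r - d.
    by near: v'; apply: nbhs_enorm_ball; rewrite subr_gt0.
  have := enorm_le_distD (v - y) (v' - y).
  rewrite opprB addrA subrK (enorm_distC v v'); lra.
move=> [N _ annulus]; have [N' _ small] := dx _ d20.
have := cly [set xs k | k in [set k | (N + N' <= k)%N]]
            [set v | enorm (v - y) < d / 2] _ (nbhs_enorm_ball y d20).
case=> [|_ [[k0 /= Nk0 <-] xk0]].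
  by exists (N + N')%N => // k /= Nk; exists k.
exists k0 => // k /= k0k; rewrite -(subnKC k0k).
apply: (@lt_trans _ _ (d / 2)); last by lra.
elim: (k - k0)%N => [|j ih]; first by rewrite addn0.
rewrite addnS; set i := (k0 + j)%N in ih *.
have ki : (N + N' <= i)%N by rewrite (leq_trans Nk0)// leq_addr.
have stepi := small i (leq_trans (leq_addl _ _) ki).
have := annulus i.+1 (leq_trans (leq_addr _ _) (leqW ki)) _ (Kx _) erefl.
move=> /negP; rewrite negb_and -!ltNge => /orP[//|far].
have := enormD (xs i.+1 - xs i) (xs i - y); rewrite addrA subrK; lra.
Unshelve. all: by end_near. Qed.

End Compactness.

(** * Theorems of the alternative *)

Section Gordan.
Context {R : realType} {n : nat}.

Lemma continuous_sum (T : topologicalType) (I : Type) (r : seq I)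
    (F : I -> T -> R) :
  (forall i, continuous (F i)) -> continuous (fun v => \sum_(i <- r) F i v).
Proof. by move=> cF v; apply: cvg_big => [|i _]; [exact: add_continuous|exact: cF]. Qed.

Lemma simplex_compact m :
  compact [set l : 'rV[R]_m | (forall i, 0 <= l 0 i <= 1) /\ \sum_i l 0 i = 1].
Proof.
rewrite (_ : [set l | _] = [set l : 'rV[R]_m | forall i, l ord0 i \in `[0, 1]] `&`
    (fun l => \sum_i l 0 i) @^-1` [set 1]); last first.
  by apply/seteqP; split=> l [lb ls]; split => // i; have := lb i; rewrite in_itv.
apply: compact_closedI.
  exact: (@rV_compact R m (fun=> `[0, 1]%classic) (fun=> @segment_compact _ _ _)).
apply: preimage_closed; last exact: closed_eq.
move=> l _; apply: continuous_sum => i; exact: coord_continuous.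
Qed.

(** Take the point [z] of least norm in the convex hull of the [a i].  If it is
    not [0], minimality towards [a i] gives [dotp (a i) z >= dotp z z > 0], so [z]
    is the direction sought. *)
Lemma gordan m (a : 'I_m.+1 -> 'rV[R]_n) :
  (exists d, forall i, 0 < dotp (a i) d) \/
  (exists l : 'I_m.+1 -> R,
    [/\ forall i, 0 <= l i, \sum_i l i = 1 & \sum_i l i *: a i = 0]).
Proof.
pose S := [set l : 'rV[R]_m.+1 |
  (forall i, 0 <= l 0 i <= 1) /\ \sum_i l 0 i = 1].
pose z (l : 'rV[R]_m.+1) := \sum_i l 0 i *: a i.
have S0 : S !=set0.
  exists (delta_mx 0 ord0); split=> [i|].
    by rewrite mxE eqxx/=; case: eqP => _; rewrite ?lexx ?ler01.
  rewrite (bigD1 ord0)//= big1 ?mxE ?eqxx ?addr0// => i i0.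
  by rewrite mxE eqxx (negbTE i0).
have cz : {within S, continuous (fun l => dotp (z l) (z l))}.
  apply: continuous_subspaceT.
  have -> : (fun l => dotp (z l) (z l)) = fun l =>
      \sum_j (\sum_i l 0 i * a i 0 j) * (\sum_i l 0 i * a i 0 j).
    apply/funext => l; rewrite dotpE; apply: eq_bigr => j _.
    by rewrite /z summxE; congr (_ * _); apply: eq_bigr => i _; rewrite mxE.
  have cj j : continuous (fun l : 'rV[R]_m.+1 => \sum_i l 0 i * a i 0 j).
    apply: continuous_sum => i l.
    apply: (@continuousM R _ (fun l : 'rV[R]_m.+1 => l 0 i) (fun=> a i 0 j)).
      exact: coord_continuous.
    exact: cst_continuous.
  by apply: continuous_sum => j l; apply: continuousM; exact: cj.
have [l] := compact_EVT_min S0 (@simplex_compact _) cz.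
rewrite inE => -[l01 lsum] lmin.
have [zz|zz] := eqVneq (dotp (z l) (z l)) 0.
  right; exists (fun i => l 0 i); split=> // [i|].
    by have /andP[] := l01 i.
  exact: (dotp_eq0 zz).
left; exists (z l) => i.
have zz0 : 0 < dotp (z l) (z l) by rewrite lt_neqAle eq_sym zz dotp_ge0.
rewrite (lt_le_trans zz0)//.
rewrite -subr_ge0 -(pmulr_rge0 _ (ltr0Sn R 1)).
apply: (@affine_ge0 _ _ (dotp (a i - z l) (a i - z l))) => t t0 t1.
pose l' : 'rV[R]_m.+1 := (1 - t) *: l + t *: delta_mx 0 i.
have l'E j : l' 0 j = (1 - t) * l 0 j + t * (i == j)%:R.
  by rewrite !mxE eqxx/= eq_sym.
have sum_delta (V : lmodType R) (F : 'I_m.+1 -> V) :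
    \sum_j (i == j)%:R *: F j = F i.
  rewrite (bigD1 i)//= eqxx scale1r big1 ?addr0// => j ji.
  by rewrite eq_sym (negbTE ji) scale0r.
have Sl' : S l'.
  split=> [j|].
    rewrite l'E; have /andP[lj0 lj1] := l01 j.
    by case: eqP => _ /=; apply/andP; split; nra.
  under eq_bigr do rewrite l'E.
  rewrite big_split/= -!mulr_sumr lsum.
  have := sum_delta R^o (fun=> 1); rewrite /GRing.scale/=.
  under eq_bigr do rewrite mulr1.
  by move=> ->; rewrite !mulr1 subrK.
have zl' : z l' = z l + t *: (a i - z l).
  rewrite /z; under eq_bigr do rewrite l'E scalerDl -!scalerA.
  rewrite big_split/= -!scaler_sumr sum_delta scalerBl scale1r scalerBr.
  by rewrite -addrA [- _ + _]addrC.
have := lmin l' (mem_set Sl'); rewrite zl' !dotp_lin => h.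
rewrite -(pmulr_rge0 _ t0); move: h; rewrite (dotpC (z l) (a i)); lra.
Qed.

(** Gordan's theorem for [- b] and the [a i], [i] in [A]: the coefficient [mu] of
    [- b] is positive, since otherwise pairing with [w] would annihilate all
    coefficients. *)
Lemma farkas_MFCQ m (b : 'rV[R]_n) (a : 'I_m -> 'rV[R]_n) (A : {set 'I_m}) w :
  (forall i, i \in A -> 0 < dotp (a i) w) ->
  (exists l : 'I_m -> R, [/\ forall i, 0 <= l i,
     forall i, i \notin A -> l i = 0 & b = \sum_i l i *: a i]) \/
  (exists2 d, dotp b d < 0 & forall i, i \in A -> 0 < dotp (a i) d).
Proof.
move=> wP.
(* Indices outside [A] repeat [- b]; their weights are collected in [mu]. *)
pose v (k : 'I_m.+1) := if unlift ord0 k is Some i then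
  if i \in A then a i else - b else - b.
have v0 : v ord0 = - b by rewrite /v unlift_none.
have vS i : v (lift ord0 i) = if i \in A then a i else - b.
  by rewrite /v liftK.
have [[d dP]|[l [l0 lsum lz]]] := gordan v.
  right; exists d; first by have := dP ord0; rewrite v0 dotpNl oppr_gt0.
  by move=> i iA; have := dP (lift ord0 i); rewrite vS iA.
left.
pose L i := l (lift ord0 i).
pose mu := l ord0 + \sum_(i | i \notin A) L i.
have comb : mu *: b = \sum_(i in A) L i *: a i.
  move: lz; rewrite big_ord_recl v0.
  under eq_bigr do rewrite vS.
  rewrite (bigID (mem A))/=.
  under eq_bigr => i iA do rewrite iA.
  under [X in _ + (_ + X)]eq_bigr => i iA do rewrite (negbTE iA) scalerN.
  rewrite sumrN -scaler_suml scalerN addrCA -opprD -scalerDl => /eqP.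
  by rewrite subr_eq0 => /eqP.
have inact0 : 0 <= \sum_(i | i \notin A) L i by apply: sumr_ge0 => i _; exact: l0.
have mu0 : 0 < mu.
  rewrite lt_neqAle addr_ge0// andbT; apply/eqP => mu0.
  move: comb; rewrite -mu0 scale0r => comb.
  have : \sum_(i in A) L i * dotp (a i) w = 0.
    under eq_bigr do rewrite -dotpZl.
    by rewrite -dotp_suml -comb -(scale0r 0) dotpZl mul0r.
  move=> /eqP; rewrite psumr_eq0; last by move=> i /wP/ltW; exact: mulr_ge0 (l0 _).
  move=> /allP act0.
  have sum_act : \sum_(i in A) L i = 0.
    apply: big1 => i iA; have := act0 i (mem_index_enum _); rewrite iA/=.
    by rewrite mulf_eq0 (gt_eqF (wP i iA)) orbF => /eqP.
  move: lsum; rewrite big_ord_recl (bigID (mem A))/=.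
  rewrite -!/(L _) sum_act add0r -/mu -mu0 => /eqP.
  by rewrite eq_sym oner_eq0.
exists (fun i => if i \in A then L i / mu else 0); split.
- by move=> i; case: ifP => // _; rewrite divr_ge0 ?l0// ltW.
- by move=> i /negbTE ->.
- rewrite (eq_bigr (fun i => mu^-1 *: (if i \in A then L i *: a i else 0))).
    by rewrite -scaler_sumr -big_mkcond/= -comb scalerA mulVf ?scale1r// gt_eqF.
  by move=> i _; case: ifP => _; rewrite ?scale0r ?scaler0// scalerA mulrC.
Qed.

End Gordan.

(** * Active constraints and the constraint qualification *)

Section Constraints.
Context {R : realType} {n m : nat}.
Implicit Types (f : 'rV[R]_n -> R) (g : 'rV[R]_n -> 'rV[R]_m) (x y w d : 'rV[R]_n).

Lemma smooth_near L f y (e : R) : smooth_with L f -> 0 < e ->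
  \forall y' \near y, `|f y' - f y| < e.
Proof.
move=> [df _] e0.
have /cvgrPdist_lt/(_ e e0) := differentiable_continuous (df y).
by apply: filterS => y'; rewrite distrC.
Qed.

Lemma grad_near L f y w (e : R) : smooth_with L f -> 0 < e ->
  \forall y' \near y, `|dotp (grad f y') w - dotp (grad f y) w| < e.
Proof.
move=> [_ lip] e0.
have Lw0 : 0 < `|L| * enorm w + 1 by rewrite ltr_wpDl// mulr_ge0// enorm_ge0.
apply: filterS (nbhs_enorm_ball y (divr_gt0 e0 Lw0)) => y'.
rewrite ltr_pdivlMr// => yy'.
rewrite -dotpNl -dotpDl (le_lt_trans (cauchy_schwarz _ _))//.
apply: le_lt_trans yy'; rewrite mulrDr mulr1 mulrA.
rewrite (@le_trans _ _ (enorm (y' - y) * `|L| * enorm w))//; last first.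
  by rewrite lerDl enorm_ge0.
rewrite ler_wpM2r ?enorm_ge0// (le_trans (lip _ _))// mulrC.
by rewrite ler_wpM2l ?enorm_ge0// ler_norm.
Qed.

Lemma active_near g y : (forall i, exists L : R, smooth_with L (constr g i)) ->
  \forall y' \near y, forall i, i \in active g y' -> i \in active g y.
Proof.
move=> sg.
apply: (@filter_forall _ _ (fun i y' => i \in active g y' -> i \in active g y)
  (nbhs y) _).
move=> i; have [L sgi] := sg i.
rewrite !inE; have [gy|gy] := leP (constr g i y) 0; first exact: nearW.
apply: filterS (smooth_near y sgi gy) => y'.
by rewrite inE ltr_distl => /andP[+ _] /le_gtF; rewrite subrr => ->.
Qed.

Lemma MFCQ_near g y : (forall i, exists L : R, smooth_with L (constr g i)) ->
  MFCQ g y -> exists w, \forall y' \near y, forall i, i \in active g y' ->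
    1 <= dotp (grad (constr g i) y') w.
Proof.
move=> sg [w0 w0P].
pose c i := dotp (grad (constr g i) y) w0.
pose t := \sum_(i in active g y) 2 / c i.
exists (t *: w0).
have tc i : i \in active g y -> 2 <= dotp (grad (constr g i) y) (t *: w0).
  move=> iy; rewrite dotpZr -ler_pdivrMr ?w0P// /t (bigD1 i)//= lerDl.
  by apply: sumr_ge0 => j /andP[jy _]; rewrite divr_ge0// ltW// w0P.
have gr : \forall y' \near y, forall i,
    `|dotp (grad (constr g i) y') (t *: w0) -
      dotp (grad (constr g i) y) (t *: w0)| < 1.
  apply: (@filter_forall _ _ (fun i y' =>
    `|dotp (grad (constr g i) y') (t *: w0) -
      dotp (grad (constr g i) y) (t *: w0)| < 1) (nbhs y) _) => i.
  by have [L sgi] := sg i; exact: grad_near sgi ltr01.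
apply: filterS2 gr (active_near y sg) => y' gr' ac i /ac/tc.
have /ltr_normlP[h _] := gr' i; atom_lra.
Qed.

(** Iterates are infeasible in general, so MFCQ is needed slightly outside of the
    feasible set, with bounded directions.  It is an open condition, hence holds
    near each feasible point, and an infeasible point has a neighbourhood whose
    violation exceeds [M^-1] for large [M]; compactness makes [M] uniform. *)
Lemma uniform_MFCQ g (K : set 'rV[R]_n) :
  (forall i, exists L : R, smooth_with L (constr g i)) ->
  (forall y, feasible g y -> MFCQ g y) -> compact K ->
  exists2 M : R, 0 < M & forall x, K x -> (forall i, - M^-1 <= constr g i x) ->
    exists2 w, enorm w <= M &
      forall i, i \in active g x -> 1 <= dotp (grad (constr g i) x) w.
Proof.
move=> sg mf /compact_near_coveringP cK.
have : \forall M \near +oo, K `<=` (fun x => (forall i, - M^-1 <= constr g i x) ->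
    exists2 w, enorm w <= M &
      forall i, i \in active g x -> 1 <= dotp (grad (constr g i) x) w).
  apply: cK => y Ky; have [fy|] := pselect (feasible g y).
    have [w wy] := MFCQ_near sg (mf y fy).
    near=> y' M => /= _; exists w; last by near: y'; exact: wy.
    by near: M; apply: nbhs_pinfty_ge; rewrite num_real.
  move=> /existsNP[i /negP]; rewrite -ltNge => gy.
  have [L sgi] := sg i.
  have gy2 : 0 < - constr g i y / 2 by atom_lra.
  near=> y' M => /= /(_ i) gM; exfalso; move: gM; apply/negP; rewrite -ltNge.
  have : `|constr g i y' - constr g i y| < - constr g i y / 2.
    by near: y'; exact: smooth_near sgi gy2.
  move=> /ltr_normlP[_ h].
  have M0 : 0 < M by near: M; exact: nbhs_pinfty_gt.
  have : M^-1 < - constr g i y / 2.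
    rewrite invf_plt ?posrE//; near: M; apply: nbhs_pinfty_gt.
    by rewrite num_real.
  atom_lra.
move=> [A [_ hA]]; have A0 : 0 < `|A| + 1 by rewrite ltr_wpDl.
exists (`|A| + 1) => // x Kx; apply: (hA (`|A| + 1)) => //.
by rewrite (le_lt_trans (ler_norm A))// ltrDl.
Unshelve. all: by end_near. Qed.

Lemma stationary_or_descent f g y : feasible g y -> MFCQ g y ->
  stationary f g y \/
  exists2 d, dotp (grad f y) d < 0 &
    forall i, i \in active g y -> 0 < dotp (grad (constr g i) y) d.
Proof.
move=> fy [w wP].
have [[l [l0 lA lE]]|] := farkas_MFCQ (grad f y) wP; last by right.
left; split=> //; exists l; split=> // i.
have [|/lA ->] := boolP (i \in active g y); last by rewrite mul0r.
rewrite inE => gi; have /eqP -> : constr g i y == 0; rewrite ?mulr0//.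
by rewrite eq_le gi fy.
Qed.

End Constraints.

(** * The iteration *)

Section Dynamics.
Context {R : realType} {n m : nat}.
Context (f : 'rV[R]_n -> R) (g : 'rV[R]_n -> 'rV[R]_m) (alpha delta beta : R).
Context (T : nat -> R) (x u : nat -> 'rV[R]_n) (U : R).
Hypothesis alpha_gt0 : 0 < alpha.
Hypothesis g_smooth : forall i, exists L : R, smooth_with L (constr g i).
Hypothesis T_vanishing : vanishing_steps T.
Hypothesis xu_iterates : iterates alpha delta beta f g T x u.
Hypothesis u_le : forall k, enorm (u k) <= U.

Let T0 k : 0 < T k := steps_gt0 T_vanishing k.

Let U0 : 0 <= U := le_trans (enorm_ge0 (u 0%N)) (u_le 0%N).

Let xS k : x k.+1 = x k + T k *: u k.+1.
Proof. by have [] := xu_iterates k. Qed.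

Let uS_feasible k : velocity_set alpha g (x k) (u k.+1).
Proof. by have [[]] := xu_iterates k. Qed.

(** One step reads [u k.+1 = u k - T k *: drift k + impulse k]: the impulse is
    what the projection onto the admissible velocities contributes. *)
Let drift k := (2 * delta) *: u k + grad f (x k + beta *: u k).

Let impulse k := u k.+1 - u k + T k *: drift k.

(** Variational inequality of the projection: [u k.+1] is the admissible velocity
    closest to [u k - T k *: drift k], and admissible velocities are convex. *)
Lemma impulse_variational k v : velocity_set alpha g (x k) v ->
  0 <= dotp (impulse k) (v - u k.+1).
Proof.
move=> vV; have [[_ umin] _] := xu_iterates k.
apply: (@affine_ge0 _ _ (dotp (v - u k.+1) (v - u k.+1) / 2)) => t t0 t1.
have : velocity_set alpha g (x k) (u k.+1 + t *: (v - u k.+1)).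
  move=> i ix; have := vV i ix; have := uS_feasible ix; rewrite !dotp_lin.
  by nra.
have nuE w : w - u k + (2 * delta * T k) *: u k + T k *: grad f (x k + beta *: u k)
    = impulse k + (w - u k.+1).
  rewrite /impulse /drift scalerDr scalerA [T k * _]mulrC.
  rewrite [RHS]addrC -!addrA; congr (w + _); rewrite [RHS]addrA addNr add0r.
  by rewrite !addrA.
move=> /umin; rewrite /velocity_cost !nuE subrr addr0 [u k.+1 + _]addrC addrK.
rewrite -(pmulr_rge0 _ t0) !enorm_sqr; move: (impulse k) (v - u k.+1) => p q.
rewrite !dotp_lin (dotpC q p); atom_lra.
Qed.

Definition violation i k := Num.max 0 (- constr g i (x k)).

Lemma violation_le i k (e : R) : violation i k <= e -> - e <= constr g i (x k).
Proof. by rewrite ge_max => /andP[_]; rewrite lerNl. Qed.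

(** An active constraint satisfies the velocity constraint
    [dotp (grad g_i) (u k.+1) >= - alpha * g_i], which contracts the violation; an
    inactive one can drop by [O(T k)] below zero.  The gradient bound is asked
    only where [g_i > 0], so that the lemma applies before [x] is known to be
    bounded. *)
Lemma violation_small i (G : R) :
  (forall k, 0 < constr g i (x k) -> enorm (grad (constr g i) (x k)) <= G) ->
  exists2 M : R, 0 <= M & \forall k \near \oo, violation i k <= M * T k.
Proof.
move=> gradG; have [L' sL'] := g_smooth i.
have [L L0 sL] : exists2 L, 0 <= L & smooth_with L (constr g i).
  by exists (Num.max 0 L'); [rewrite le_max lexx|exact: smooth_with_max0].
pose c := `|G| * U + L * U ^+ 2.
have c1 : 0 <= `|G| * U by rewrite mulr_ge0.
have c2 : 0 <= L * U ^+ 2 by rewrite mulr_ge0// sqr_ge0.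
have tay k : constr g i (x k) + T k * dotp (grad (constr g i) (x k)) (u k.+1)
    - L * U ^+ 2 * T k ^+ 2 <= constr g i (x k.+1).
  have := smooth_taylor (x k) (T k *: u k.+1) L0 sL.
  rewrite -xS enormZ (gtr0_norm (T0 k)) dotpZr => /ler_normlP[h _].
  have : L * (T k * enorm (u k.+1)) ^+ 2 <= L * U ^+ 2 * T k ^+ 2.
    rewrite exprMn mulrCA [leRHS]mulrC ler_wpM2l ?sqr_ge0// ler_wpM2l//.
    by rewrite ler_pXn2r ?nnegrE ?enorm_ge0.
  move: h; atom_lra.
apply: (contracted_or_reset T_vanishing alpha_gt0 (addr_ge0 c1 c2)) => [k|].
  by rewrite le_max lexx.
have ai : 0 < alpha^-1 by rewrite invr_gt0.
near=> k.
have T1 : T k < 1 by near: k; exact: steps_small T_vanishing ltr01.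
have aT : alpha * T k < 1.
  by rewrite -ltr_pdivlMl// mulr1; near: k; exact: steps_small T_vanishing ai.
have Tk := T0 k; have := tay k.
have Tsq : 0 <= T k ^+ 2 by exact: sqr_ge0.
have GT : 0 <= `|G| * U * T k ^+ 2 by rewrite mulr_ge0.
have LT : 0 <= L * U ^+ 2 * T k ^+ 2 by rewrite mulr_ge0.
have p0 : 0 <= violation i k by rewrite le_max lexx.
have [act|inact] := leP (constr g i (x k)) 0; [left|right]; rewrite ge_max.
- have := @uS_feasible k i; rewrite inE => /(_ act) uV.
  have vE : violation i k = - constr g i (x k) by rewrite /violation max_r ?oppr_ge0.
  rewrite vE in p0 *; apply/andP; split.
    apply: addr_ge0; last by rewrite mulr_ge0// addr_ge0.
    by rewrite mulr_ge0// subr_ge0 ltW.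
  have : 0 <= T k * (dotp (grad (constr g i) (x k)) (u k.+1) +
                     alpha * constr g i (x k)) by rewrite mulr_ge0// ltW.
  atom_lra.
- apply/andP; split; first by rewrite mulr_ge0 ?(ltW Tk)// addr_ge0.
  have gu : - (`|G| * U) <= dotp (grad (constr g i) (x k)) (u k.+1).
    apply: le_trans (dotp_geN _ _); rewrite lerN2 ler_pM ?enorm_ge0//.
    by rewrite (le_trans (gradG k inact))// ler_norm.
  have : T k * - (`|G| * U) <= T k * dotp (grad (constr g i) (x k)) (u k.+1).
    by rewrite ler_wpM2l// ltW.
  have : L * U ^+ 2 * T k ^+ 2 <= L * U ^+ 2 * T k.
    by rewrite ler_wpM2l// expr2 ler_piMl// ltW.
  rewrite /c; atom_lra.
Unshelve. all: by end_near. Qed.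

Lemma violations_small (K : set 'rV[R]_n) : compact K -> (forall k, K (x k)) ->
  exists2 M : R, 0 <= M &
    \forall k \near \oo, forall i, violation i k <= M * T k.
Proof.
move=> cK Kx; have [B B0 KB] := compact_enorm_bounded cK.
have /choice[M MP] : forall i, exists M : R,
    0 <= M /\ \forall k \near \oo, violation i k <= M * T k.
  move=> i; have [L sL] := g_smooth i.
  have sL' := smooth_with_max0 sL.
  have [|M M0 MP] := @violation_small i
      (enorm (grad (constr g i) 0) + Num.max 0 L * B).
    move=> k _; apply: le_trans (grad_bound _ sL') _.
    by rewrite lerD2l ler_wpM2l ?le_max ?lexx// KB.
  by exists M.
exists (\sum_i M i); first by apply: sumr_ge0 => i _; exact: (MP i).1.
have : \forall k \near \oo, forall i, violation i k <= M i * T k.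
  apply: (@filter_forall _ _ (fun i k => violation i k <= M i * T k) \oo _) => i.
  exact: (MP i).2.
apply: filterS => k Mk i; apply: le_trans (Mk i) _.
rewrite ler_wpM2r ?(ltW (T0 k))// (bigD1 i)//= lerDl.
by apply: sumr_ge0 => j _; exact: (MP j).1.
Qed.

(** Over an exactly feasible point [0] is an admissible velocity, and the impulse
    does no positive work.  Here a multiple [O(T k)] of an MFCQ direction
    replaces [0]. *)
Lemma impulse_almost_dissipates (K : set 'rV[R]_n) : compact K ->
  (forall k, K (x k)) -> (forall y, feasible g y -> MFCQ g y) ->
  exists2 C : R, 0 <= C &
    \forall k \near \oo, dotp (impulse k) (u k.+1) <= C * T k * enorm (impulse k).
Proof.
move=> cK Kx mf; have [M M0 vM] := violations_small cK Kx.
have [D D0 KD] := uniform_MFCQ g_smooth mf cK.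
exists (alpha * M * D); first by rewrite !mulr_ge0// ltW.
have DM0 : 0 < D^-1 / (M + 1) by rewrite divr_gt0 ?invr_gt0// ltr_wpDl.
near=> k.
have Tk : 0 < T k := T0 k.
have vk i : violation i k <= M * T k by move: i; near: k.
have MT : M * T k <= D^-1.
  have : T k < D^-1 / (M + 1) by near: k; exact: steps_small T_vanishing DM0.
  rewrite ltr_pdivlMr ?ltr_wpDl// => h; atom_lra.
have [i|w wD wP] := KD (x k) (Kx k).
  by apply: violation_le; exact: le_trans (vk i) MT.
have : velocity_set alpha g (x k) ((alpha * M * T k) *: w).
  move=> i ix; rewrite dotpZr.
  have := violation_le (vk i); have := wP i ix.
  move: (dotp _ _) (constr _ _ _) => a b a1 b1.
  have AM : 0 <= alpha * M * T k by rewrite !mulr_ge0// ltW.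
  have : alpha * M * T k * 1 <= alpha * M * T k * a by rewrite ler_wpM2l.
  have : alpha * - (M * T k) <= alpha * b by rewrite ler_pM2l.
  atom_lra.
move=> /impulse_variational; rewrite dotpDr dotpNr dotpZr subr_ge0 => /le_trans; apply.
have AMT : 0 <= alpha * M * T k by rewrite !mulr_ge0// ltW.
rewrite [leRHS](_ : _ = alpha * M * T k * (D * enorm (impulse k))); last by ring.
rewrite ler_wpM2l// (le_trans (dotp_le _ _))// mulrC ler_wpM2r// enorm_ge0.
Unshelve. all: by end_near. Qed.

Hypothesis delta_gt0 : 0 < delta.
Hypothesis beta_ge0 : 0 <= beta.
Hypothesis f_smooth : smooth_with 1 f.

(** Friction dominates the error made by evaluating the gradient at
    [y + beta *: v]: by monotonicity that error has a favourable sign when [f] is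
    convex, and it costs [beta * |v| ^ 2] at most otherwise. *)
Lemma drift_dissipates : convex_function setT f \/ 0 < 2 * delta - beta ->
  exists2 c : R, 0 < c & forall y v, c * dotp v v + dotp (grad f y) v <=
    dotp ((2 * delta) *: v + grad f (y + beta *: v)) v.
Proof.
case=> [cf|db].
  exists (2 * delta) => [|y v]; first by rewrite mulr_gt0.
  rewrite dotpDl dotpZl lerD2l.
  move: beta_ge0; rewrite le_eqVlt => /predU1P[<-|b0].
    by rewrite scale0r addr0.
  have := convex_grad_monotone y (beta *: v) ler01 f_smooth cf.
  move: (grad f y) (grad f (y + beta *: v)) => a b.
  by rewrite dotpZr pmulr_rge0// dotpDl dotpNl subr_ge0.
exists (2 * delta - beta) => // y v.
rewrite dotpDl dotpZl.
have := dotp_geN (grad f (y + beta *: v) - grad f y) v.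
have [_ lip] := f_smooth.
have : enorm (grad f (y + beta *: v) - grad f y) * enorm v <= beta * dotp v v.
  rewrite -enorm_sqr expr2 mulrA ler_wpM2r ?enorm_ge0// (le_trans (lip _ _))//.
  by rewrite mul1r [_ - y]addrAC subrr add0r enormZ ger0_norm.
move: (grad f y) (grad f (y + beta *: v)) => a b; rewrite dotpDl dotpNl; atom_lra.
Qed.

(** The impulse may be of order one, so no term linear in it can be treated as an
    error.  Each comes with a factor [T k] and is absorbed by completing the
    square with the loss [enorm (impulse k) ^+ 2 / 2] of the projection. *)
Lemma energy_step (C c B : R) k : 0 <= C -> 0 <= B -> 0 < c ->
  enorm (grad f (x k)) <= B -> enorm (drift k) <= B -> T k <= 1 ->
  dotp (impulse k) (u k.+1) <= C * T k * enorm (impulse k) ->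
  c * dotp (u k) (u k) + dotp (grad f (x k)) (u k) <= dotp (drift k) (u k) ->
  dotp (u k.+1) (u k.+1) <=
    dotp (u k) (u k) + (2 * U * B + B ^+ 2 + C ^+ 2) * T k /\
  dotp (u k.+1) (u k.+1) / 2 + f (x k.+1) <= dotp (u k) (u k) / 2 + f (x k)
    - c * (T k * dotp (u k) (u k))
    + (3 / 2 * B ^+ 2 + (C + B) ^+ 2 / 2 + U ^+ 2) * T k ^+ 2.
Proof.
move=> C0 B0 c0 gB hB T1 impC diss; have Tk := T0 k.
have uE : u k.+1 = u k - T k *: drift k + impulse k.
  by rewrite /impulse [u k.+1 - u k + _]addrC addrA subrK subrKC.
have Tsq : T k ^+ 2 <= T k by rewrite expr2 ler_piMr// ltW.
have T2 : 0 <= T k ^+ 2 by exact: sqr_ge0.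
have fS : f (x k.+1) <= f (x k) + T k * dotp (grad f (x k)) (u k.+1) +
    U ^+ 2 * T k ^+ 2.
  have := smooth_taylor (x k) (T k *: u k.+1) ler01 f_smooth.
  rewrite -xS enormZ (gtr0_norm Tk) dotpZr exprMn => /ler_normlP[_].
  have : T k ^+ 2 * enorm (u k.+1) ^+ 2 <= T k ^+ 2 * U ^+ 2.
    by rewrite ler_wpM2l// ler_pXn2r ?nnegrE ?enorm_ge0.
  atom_lra.
have fu : dotp (grad f (x k)) (impulse k) <= B * enorm (impulse k).
  by rewrite (le_trans (dotp_le _ _))// ler_wpM2r ?enorm_ge0.
have fh : - B ^+ 2 <= dotp (grad f (x k)) (drift k).
  by rewrite (le_trans _ (dotp_geN _ _))// lerN2 expr2 ler_pM ?enorm_ge0.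
have uh : - (U * B) <= dotp (u k) (drift k).
  by rewrite (le_trans _ (dotp_geN _ _))// lerN2 ler_pM ?enorm_ge0.
have hh : dotp (drift k) (drift k) <= B ^+ 2.
  by rewrite -enorm_sqr ler_pXn2r ?nnegrE ?enorm_ge0.
have ii := enorm_sqr (impulse k).
move: impC diss fS fu fh uh hh ii.
rewrite (dotpC (drift k)) uE; move: (f (x k.+1)) (f (x k)) => fx1 fx0.
move: (grad f (x k)) (drift k) (impulse k) (u k) (enorm (impulse k)).
move=> q h p v a; rewrite !dotp_lin (dotpC h v) (dotpC p v) (dotpC p h).
move: (T k) Tk Tsq T2 (dotp v v) (dotp v h) (dotp h h) (dotp p p) (dotp v p)
  (dotp h p) (dotp q v) (dotp q h) (dotp q p) => t t0 tt t2.
move=> vv vh hh pp vp hp qv qh qp impC diss fS fu fh uh hhB ii.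
(* The two squares completed, one for each inequality. *)
have F1 : 0 <= (C * t - a) ^+ 2 by exact: sqr_ge0.
have F2 : 0 <= ((C + B) * t - a) ^+ 2 by exact: sqr_ge0.
have F3 : t ^+ 2 * hh <= t ^+ 2 * B ^+ 2 by rewrite ler_wpM2l.
have F4 : t * - (U * B) <= t * vh by rewrite ler_pM2l.
have F5 : t ^+ 2 * - B ^+ 2 <= t ^+ 2 * qh by rewrite ler_wpM2l.
have F6 : t * qp <= t * (B * a) by rewrite ler_pM2l.
have F7 : t * (c * vv + qv) <= t * vh by rewrite ler_pM2l.
have F8 : B ^+ 2 * t ^+ 2 <= B ^+ 2 * t by rewrite ler_wpM2l ?sqr_ge0.
have F9 : C ^+ 2 * t ^+ 2 <= C ^+ 2 * t by rewrite ler_wpM2l ?sqr_ge0.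
split; atom_lra.
Qed.

(** The energy is bounded below on the compact set, so the dissipated amount
    [T * |u| ^ 2] is summable. *)
Lemma velocity_vanishes (K : set 'rV[R]_n) : compact K -> (forall k, K (x k)) ->
  (forall y, feasible g y -> MFCQ g y) ->
  convex_function setT f \/ 0 < 2 * delta - beta ->
  forall e : R, 0 < e -> \forall k \near \oo, enorm (u k) < e.
Proof.
move=> cK Kx mf cvx e e0.
have [C C0 impC] := impulse_almost_dissipates cK Kx mf.
have [c c0 diss] := drift_dissipates cvx.
have [X X0 KX] := compact_enorm_bounded cK.
have [B B0 [gB hB]] : exists2 B : R, 0 <= B &
    (forall k, enorm (grad f (x k)) <= B) /\ (forall k, enorm (drift k) <= B).
  exists (2 * delta * U + (enorm (grad f 0) + (X + beta * U))).
    by rewrite !addr_ge0 ?mulr_ge0 ?enorm_ge0// ltW.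
  have dU : 0 <= 2 * delta * U by rewrite !mulr_ge0// ltW.
  have bU : 0 <= beta * U by rewrite mulr_ge0.
  split=> k.
    by have := grad_bound (x k) f_smooth; have := KX _ (Kx k); atom_lra.
  apply: le_trans (enormD _ _) _.
  have : enorm ((2 * delta) *: u k) <= 2 * delta * U.
    by rewrite enormZ ger0_norm ?mulr_ge0 ?(ltW delta_gt0)// ler_wpM2l ?mulr_ge0// ltW.
  have : enorm (beta *: u k) <= beta * U by rewrite enormZ ger0_norm// ler_wpM2l.
  have := grad_bound (x k + beta *: u k) f_smooth.
  have := enormD (x k) (beta *: u k); have := KX _ (Kx k); atom_lra.
have [fm fmin] : exists fm : R, forall k, fm <= f (x k).
  have cf : {within K, continuous f}.
    apply: continuous_subspaceT => y; apply: differentiable_continuous.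
    exact: f_smooth.1.
  have [|y _ ymin] := compact_EVT_min _ cK cf; first by exists (x 0%N).
  by exists (f y) => k; apply: ymin; rewrite inE.
pose y k := dotp (u k) (u k).
pose V k := y k / 2 + f (x k).
pose D := 2 * U * B + B ^+ 2 + C ^+ 2.
pose E := 3 / 2 * B ^+ 2 + (C + B) ^+ 2 / 2 + U ^+ 2.
have y0 k : 0 <= y k by exact: dotp_ge0.
have Ty0 k : 0 <= T k * y k by rewrite mulr_ge0// (ltW (T0 k)).
have E0 : 0 <= E.
  have := sqr_ge0 B; have := sqr_ge0 (C + B); have := sqr_ge0 U; rewrite /E; lra.
have st : \forall k \near \oo, y k.+1 <= y k + D * T k /\
    V k.+1 <= V k - c * (T k * y k) + E * T k ^+ 2.
  near=> k; apply: (energy_step C0 B0 c0 (gB k) (hB k)).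
  - by apply: ltW; near: k; exact: steps_small T_vanishing ltr01.
  - by near: k.
  - exact: diss.
have [||||| cT _] := @perturbed_descent _ V (fun k => c * (T k * y k))
    (fun k => E * T k ^+ 2) fm.
- by move=> k; rewrite mulr_ge0// ltW.
- by move=> k; rewrite mulr_ge0// sqr_ge0.
- rewrite (_ : (fun k => _) = E *: (fun k => T k ^+ 2)) //.
  by apply: is_cvg_seriesZ; exact: steps_sqr.
- by move=> k; rewrite /V; have := fmin k; have := y0 k; atom_lra.
- by apply: filterS st => k [].
have cTy : cvgn (series (fun k => T k * y k)).
  have -> : (fun k => T k * y k) = c^-1 *: (fun k => c * (T k * y k)).
    by apply/funext => k; rewrite fctE /GRing.scale/= mulKf// gt_eqF.
  exact: is_cvg_seriesZ.
have D0 : 0 <= D by rewrite /D !addr_ge0 ?sqr_ge0 ?mulr_ge0.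
have yS : \forall k \near \oo, y k.+1 <= y k + D * T k by apply: filterS st => k [].
have /cvgrPdist_lt/(_ (e ^+ 2)) := weighted_summable_cvg0 T_vanishing D0 y0 cTy yS.
rewrite exprn_gt0// => /(_ isT); apply: filterS => k.
rewrite sub0r normrN ger0_norm// /y -enorm_sqr ltr_pXn2r ?nnegrE ?enorm_ge0//.
exact: ltW.
Unshelve. all: by end_near. Qed.

(** At a nonstationary cluster point [y] the velocity would gain momentum in a
    descent direction [d] as long as [x] stays near [y].  With
    [enorm (u k) <= eta] this can last for a time [2 * eta * |d| / c] at most,
    during which [x] moves by [2 * eta ^ 2 * |d| / c], less than needed to
    leave. *)
Lemma cluster_stationary (K : set 'rV[R]_n) : compact K -> (forall k, K (x k)) ->
  (forall y, feasible g y -> MFCQ g y) ->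
  (forall e : R, 0 < e -> \forall k \near \oo, enorm (u k) < e) ->
  cluster (x @ \oo) `<=` stationary f g.
Proof.
move=> cK Kx mf u_small y cly.
have fy : feasible g y.
  move=> i; rewrite leNgt; apply/negP => gy.
  have [L sgi] := g_smooth i.
  have [M M0 vM] := violations_small cK Kx.
  have gy2 : 0 < - constr g i y / 2 by atom_lra.
  have gM : 0 < - constr g i y / 2 / (M + 1) by rewrite divr_gt0// ltr_wpDl.
  have FA : (x @ \oo) [set v | constr g i y / 2 < constr g i v].
    have : \forall k \near \oo, constr g i y / 2 < constr g i (x k).
      near=> k.
      have vk j : violation j k <= M * T k by move: j; near: k.
      have := violation_le (vk i).
      have : T k < - constr g i y / 2 / (M + 1).
        by near: k; exact: (steps_small T_vanishing gM).
      rewrite ltr_pdivlMr ?ltr_wpDl//; have := T0 k; atom_lra.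
    by [].
  have [v [/= v1]] := cly _ _ FA (smooth_near y sgi gy2).
  by move=> /ltr_normlP[_ v2]; atom_lra.
have [//|[d fd gd]] := stationary_or_descent f fy (mf y fy); exfalso.
pose c := - dotp (grad f y) d / 4.
have c0 : 0 < c by rewrite /c; atom_lra.
have [r r0 rP] : exists2 r : R, 0 < r & forall v, enorm (v - y) < r ->
    dotp (grad f v) d <= - 2 * c /\
    (forall i, i \in active g v -> 0 < dotp (grad (constr g i) v) d).
  apply/nbhs_enorm; near=> v; split.
    have : `|dotp (grad f v) d - dotp (grad f y) d| < c.
      by near: v; exact: grad_near f_smooth c0.
    by move=> /ltr_normlP[_]; rewrite /c; atom_lra.
  near: v; apply: filterS2 (active_near y g_smooth) _; last first.
    apply: (@filter_forall _ _ (fun i v => i \in active g y ->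
      0 < dotp (grad (constr g i) v) d) (nbhs y) _) => i.
    have [iy|_] := boolP (i \in active g y); last exact: nearW.
    have [L sgi] := g_smooth i.
    apply: filterS (grad_near y d sgi (gd i iy)) => v /ltr_normlP[h _] _; atom_lra.
  by move=> v av gv i /av /gv.
pose D := enorm d; have D0 : 0 <= D := enorm_ge0 d.
(* [eta * q <= c] keeps the terms of the drift that are linear in [u] below [c],
   and the distance travelled below [r / 2]. *)
pose q := (2 * delta + beta) * D + 4 * D / r + 1.
have q1 : 0 <= (2 * delta + beta) * D.
  by rewrite mulr_ge0// addr_ge0// mulr_ge0// ltW.
have q2 : 0 <= 4 * D / r by rewrite divr_ge0 ?mulr_ge0// ltW.
have q0 : 0 < q by rewrite /q; lra.
have [eta [eta0 eta1 etaq]] : exists eta : R, [/\ 0 < eta, eta <= 1 & eta * q <= c].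
  exists (Num.min 1 (c / q)); rewrite -ler_pdivlMr// !ge_min !lexx orbT; split=> //.
  by rewrite lt_min ltr01 divr_gt0.
have [N _ uN] := u_small _ eta0.
have grow k : (N <= k)%N -> enorm (x k - y) < r ->
    dotp (u k) d + c * T k <= dotp (u k.+1) d.
  move=> Nk xk; have [fx gx] := rP _ xk.
  have imp0 : 0 <= dotp (impulse k) d.
    have : velocity_set alpha g (x k) (u k.+1 + d).
      move=> i ix; have := uS_feasible ix; have := gx i ix.
      by rewrite dotpDr; atom_lra.
    by move=> /impulse_variational; rewrite [u k.+1 + d]addrC addrK.
  have h1 : dotp (drift k) d <= - c.
    have := cauchy_schwarz (u k) d; have := cauchy_schwarz
      (grad f (x k + beta *: u k) - grad f (x k)) d.
    have [_ lip] := f_smooth; have uk := uN _ Nk.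
    have : enorm (grad f (x k + beta *: u k) - grad f (x k)) * D <= beta * eta * D.
      rewrite ler_wpM2r// (le_trans (lip _ _))// mul1r [_ - x k]addrAC subrr add0r.
      by rewrite enormZ ger0_norm// ler_wpM2l// ltW.
    have : 2 * delta * (enorm (u k) * D) <= 2 * delta * (eta * D).
      by rewrite ler_wpM2l ?mulr_ge0 ?(ltW delta_gt0)// ler_wpM2r// ltW.
    move=> e1 e2 /ler_normlP[_ e3] /ler_normlP[_ e4].
    have : 2 * delta * dotp (u k) d <= 2 * delta * (enorm (u k) * D).
      by rewrite ler_wpM2l// mulr_ge0// ltW.
    have : 0 <= eta * (4 * D / r + 1) by rewrite mulr_ge0 ?addr_ge0// ltW.
    move: e3 etaq; rewrite dotpDl dotpNl dotpDl dotpZl /q.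
    move: fx; rewrite -/D; atom_lra.
  have : dotp (impulse k) d = dotp (u k.+1) d - dotp (u k) d + T k * dotp (drift k) d.
    by rewrite dotpDl (dotpDl (u k.+1)) dotpNl dotpZl.
  have : T k * dotp (drift k) d <= T k * - c by rewrite ler_wpM2l// ltW.
  atom_lra.
have [k0 Nk0 xk0] : exists2 k0, (N <= k0)%N & enorm (x k0 - y) < r / 2.
  have r2 : 0 < r / 2 by rewrite divr_gt0.
  have := cly [set x k | k in [set k | (N <= k)%N]] _ _ (nbhs_enorm_ball y r2).
  case=> [|_ [[k0 /= Nk0 <-] xk0]]; first by exists N => // k /= Nk; exists k.
  by exists k0.
(* The time elapsed since step [k0], as an opaque function. *)
have [S SE] : exists S : nat -> R,
    forall j, S j = series T (k0 + j)%N - series T k0 by eexists.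
have ud k : (N <= k)%N -> `|dotp (u k) d| <= eta * D.
  move=> Nk; rewrite (le_trans (cauchy_schwarz _ _))// ler_wpM2r//.
  by apply/ltW/uN.
have trapped j : [/\ dotp (u k0) d + c * S j <= dotp (u (k0 + j)%N) d,
    enorm (x (k0 + j)%N - y) <= r / 2 + eta * S j & enorm (x (k0 + j)%N - y) < r].
  have inball i : 0 <= S i -> (N <= k0 + i)%N ->
      dotp (u k0) d + c * S i <= dotp (u (k0 + i)%N) d ->
      enorm (x (k0 + i)%N - y) <= r / 2 + eta * S i -> enorm (x (k0 + i)%N - y) < r.
    move=> Si0 Ni ui xi; apply: le_lt_trans xi _.
    have /ler_normlP[a1 _] := ud _ Nk0; have /ler_normlP[_ a2] := ud _ Ni.
    have cS : c * S i <= 2 * (eta * D) by atom_lra.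
    have e4 : eta * (4 * D / r) < c.
      have : 0 <= eta * ((2 * delta + beta) * D) by rewrite mulr_ge0// ltW.
      by move: etaq; rewrite /q; atom_lra.
    have e5 : 4 * (eta * D) < c * r.
      by rewrite -ltr_pdivrMr//; move: e4; rewrite !mulrA; atom_lra.
    have : eta * S i <= S i by rewrite ler_piMl.
    have : c * S i < c * (r / 2) by atom_lra.
    by rewrite ltr_pM2l//; atom_lra.
  elim: j => [|j [uj xj bj]].
    have S0 : S 0%N = 0 by rewrite SE addn0 subrr.
    by rewrite S0 addn0 !mulr0 !addr0; split=> //; [exact: ltW|lra].
  have Nj : (N <= k0 + j)%N by rewrite (leq_trans Nk0)// leq_addr.
  have SS : S j.+1 = S j + T (k0 + j)%N by rewrite !SE addnS seriesSr; lra.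
  have Sj0 : 0 <= S j.+1.
    by rewrite SE subr_ge0 (nondecreasing_series (fun i _ _ => ltW (T0 i)))// leq_addr.
  have uj1 : dotp (u k0) d + c * S j.+1 <= dotp (u (k0 + j.+1)%N) d.
    by have := grow _ Nj bj; rewrite SS addnS; atom_lra.
  have xj1 : enorm (x (k0 + j.+1)%N - y) <= r / 2 + eta * S j.+1.
    rewrite addnS xS addrAC (le_trans (enormD _ _))// enormZ (gtr0_norm (T0 _)) SS.
    have h : T (k0 + j)%N * enorm (u (k0 + j).+1) <= eta * T (k0 + j)%N.
      rewrite [leRHS]mulrC ler_wpM2l ?(ltW (T0 _))//.
      by apply/ltW/uN; exact: leqW Nj.
    by rewrite (le_trans (lerD xj h))// mulrDr addrA.
  split=> //; apply: inball => //.
  by rewrite (leq_trans Nk0)// leq_addr.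
have [k Sk] := steps_dvgP (series T k0 + 2 * (eta * D) / c) T_vanishing.
have [j kE] : exists j, (k <= k0 + j)%N by exists k; rewrite leq_addl.
have [uj _ _] := trapped j.
have /ler_normlP[a1 _] := ud _ Nk0.
have /ler_normlP[_ a2] := ud (k0 + j)%N (leq_trans Nk0 (leq_addr _ _)).
have : series T k <= series T (k0 + j)%N.
  exact: (nondecreasing_series (fun i _ _ => ltW (T0 i))).
have : 2 * (eta * D) / c < S j -> 2 * (eta * D) < c * S j.
  by rewrite ltr_pdivrMr// [S j * c]mulrC.
rewrite SE in uj *; atom_lra.
Unshelve. all: by end_near. Qed.

End Dynamics.

Theorem theorem3 (R : realType) (n m : nat)
    (f : 'rV[R]_n -> R) (g : 'rV[R]_n -> 'rV[R]_m.+1)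
    (alpha delta beta T0 s : R) (x u : nat -> 'rV[R]_n)
    (alpha_gt0 : 0 < alpha) (delta_gt0 : 0 < delta) (beta_ge0 : 0 <= beta)
    (T0_gt0 : 0 < T0) (s_gt : 2^-1 < s) (s_lt : s < 1)
    (f_coercive : coercive f)
    (C_compact : compact (feasible g))
    (g_smooth : forall i, exists L : R, smooth_with L (constr g i))
    (g1_levels : compact_level_sets (fun y => Num.min 0 (constr g ord0 y)))
    (f_smooth : smooth_with 1 f)
    (f_convex_or : convex_function setT f \/ 0 < 2 * delta - beta)
    (g_MFCQ : forall y, feasible g y -> MFCQ g y)
    (xu_iterates : iterates alpha delta beta f g (step T0 s) x u)
    (u_bounded : bounded_fun u)
    (stationary_isolated : stationary f g `<=` isolated (stationary f g)) :
  exists2 xbar : 'rV[R]_n, stationary f g xbar &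
    (x k @[k --> \oo] --> xbar) /\ (u k @[k --> \oo] --> (0 : 'rV[R]_n)).
Proof.
have [U uU] : exists U : R, forall k, enorm (u k) <= U.
  have [M [_ uM]] := u_bounded.
  exists (n.+1%:R * (`|M| + 1)) => k; apply: le_trans (enorm_le_norm _) _.
  by rewrite ler_wpM2l// uM// (le_lt_trans (ler_norm M))// ltrDl.
have vT := step_vanishing T0_gt0 s_gt s_lt.
have [K cK Kx] : exists2 K, compact K & forall k, K (x k).
  have [B B0 KB] := compact_enorm_bounded (g1_levels 0).
  have [L sL] := g_smooth ord0; have sL' := smooth_with_max0 sL.
  have [|M M0 vM] := @violation_small _ _ _ _ _ _ _ _ _ _ _ _ alpha_gt0 g_smooth
      vT xu_iterates uU ord0 (enorm (grad (constr g ord0) 0) + Num.max 0 L * B).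
    move=> k gk; apply: le_trans (grad_bound _ sL') _.
    by rewrite lerD2l ler_wpM2l ?le_max ?lexx// KB//= le_min lexx ltW.
  have [//|//|C vC] := @near_bounded_above _ (violation g x ord0) M _ _.
  - by move=> k; rewrite le_max lexx.
  - near=> k; have : step T0 s k < 1 by near: k; exact: steps_small vT ltr01.
    have : violation g x ord0 k <= M * step T0 s k by near: k.
    move=> /le_trans vk /ltW T1; apply: vk; exact: ler_piMr.
  exists [set y | - C <= Num.min 0 (constr g ord0 y)]; first exact: g1_levels.
  move=> k /=; rewrite le_min (violation_le (vC k)) andbT oppr_le0.
  by apply: le_trans (vC k); rewrite le_max lexx.
have u_small := velocity_vanishes alpha_gt0 g_smooth vT
  xu_iterates uU delta_gt0 beta_ge0 f_smooth cK Kx g_MFCQ f_convex_or.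
have clS := cluster_stationary alpha_gt0 g_smooth vT
  xu_iterates uU delta_gt0 beta_ge0 f_smooth cK Kx g_MFCQ u_small.
have [|xbar sx cx] := isolated_cluster_cvg cK Kx _ clS stationary_isolated.
  move=> e e0.
  have U1 : 0 < U + 1 by rewrite ltr_wpDl// (le_trans (enorm_ge0 (u 0%N))).
  near=> k.
  have [_ ->] := xu_iterates k.
  rewrite addrAC subrr add0r enormZ (gtr0_norm (steps_gt0 vT k)).
  have T0k := steps_gt0 vT k.
  have : step T0 s k < e / (U + 1).
    by near: k; apply: (steps_small vT); exact: divr_gt0 e0 U1.
  rewrite ltr_pdivlMr//; apply: le_lt_trans; rewrite ler_wpM2l ?(ltW T0k)//.
  by rewrite (le_trans (uU _))// lerDl.
exists xbar => //; split=> //; apply: cvg_enorm => e e0.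
by under eq_near do rewrite subr0; exact: u_small.
Unshelve. all: by end_near. Qed.
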